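(* Let $(A,\mu_A,\alpha_A)$ and $(B,\mu_B,\alpha_B)$ be two Hom-associative algebras over a field $k$, and let $R:B\otimes A\to A\otimes B$ and $Q:A\otimes B\to A\otimes B$ be two linear maps, with notation $R(b\otimes a)=a_R\otimes b_R=a_r\otimes b_r$ and $Q(a\otimes b)=a_Q\otimes b_Q=a_q\otimes b_q$ for $a\in A$, $b\in B$. Assume that for all $a,a'\in A$ and $b,b'\in B$: \begin{align*} &\alpha_A(a_R)\otimes\alpha_B(b_R)=\alpha_A(a)_R\otimes\alpha_B(b)_R,\\ &\alpha_A(a_Q)\otimes\alpha_B(b_Q)=\alpha_A(a)_Q\otimes\alpha_B(b)_Q,\\ &(aa')_R\otimes\alpha_B(b)_R=a_Ra'_r\otimes\alpha_B((b_R)_r),\\ &\alpha_A(a)_R\otimes(bb')_R=\alpha_A((a_R)_r)\otimes b_rb'_R,\\ &(aa')_Q\otimes\alpha_B(b)_Q=a_qa'_Q\otimes\alpha_B((b_Q)_q),\\ &\alpha_A(a)_Q\otimes(bb')_Q=\alpha_A((a_Q)_q)\otimes b_Qb'_q,\\ &b_R\otimes(a_R)_Q\otimes b'_Q=b_R\otimes(a_Q)_R\otimes b'_Q,\\ &a_R\otimes(b_R)_Q\otimes a'_Q=a_R\otimes(b_Q)_R\otimes a'_Q. \end{align*} Define a multiplication on $A\otimes B$ by $(a\otimes b)(a'\otimes b')=a_Qa'_R\otimes b_Rb'_Q$. Then $A\otimes B$ with this multiplication and structure map $\alpha_A\otimes\alpha_B$ is a Hom-associative algebra.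
   Context: Everything is over a field $k$, $\otimes=\otimes_k$. Algebras are not assumed associative or unital; multiplication is written by juxtaposition. A Hom-associative algebra is a triple $(A,\mu,\alpha)$ with $A$ a vector space, $\mu:A\otimes A\to A$ (written $\mu(a\otimes a')=aa'$) and $\alpha:A\to A$ linear (the structure map), such that $\alpha(aa')=\alpha(a)\alpha(a')$ and $\alpha(a)(a'a'')=(aa')\alpha(a'')$ for all $a,a',a''\in A$. The notation $a_R\otimes b_R$ is Sweedler-type: a sum of simple tensors is implied, and different letters ($R$, $r$; $Q$, $q$) denote different applications of the same map. For instance $a_Ra'_r\otimes(b_R)_r$ means: apply $R$ to $b\otimes a$ to get $a_R\otimes b_R$, then apply $R$ to $b_R\otimes a'$ to get $a'_r\otimes(b_R)_r$, and multiply the $A$-components in the indicated order. Likewise $b_R\otimes (a_R)_Q\otimes b'_Q$ means: apply $R$ to $b\otimes a$, then $Q$ to $a_R\otimes b'$; while $b_R\otimes(a_Q)_R\otimes b'_Q$ means: apply $Q$ to $a\otimes b'$, then $R$ to $b\otimes a_Q$. Similarly $a_R\otimes(b_R)_Q\otimes a'_Q$ means: apply $R$ to $b\otimes a$, then $Q$ to $a'\otimes b_R$; and $a_R\otimes(b_Q)_R\otimes a'_Q$: apply $Q$ to $a'\otimes b$, then $R$ to $b_Q\otimes a$. *)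

(* Defs.v *)
From HB Require Import structures.
From mathcomp Require Import all_boot all_algebra.
From mathcomp Require Import generic_quotient ring_quotient sesquilinear.
From mathcomp Require Import boolp.
From mathcomp.multinomials Require Import freeg.

Set Implicit Arguments.
Unset Strict Implicit.
Unset Printing Implicit Defensive.

Import GRing.Theory.
Local Open Scope ring_scope.
Local Open Scope quotient_scope.

(* The library has no tensor product of arbitrary vector spaces: it is built  *)
(* here as the free vector space on the set A * B modulo the subspace spanned *)
(* by the bilinearity relations.                                              *)
Section TensorProduct.
Variables (k : fieldType) (A B : lmodType k).

Definition tgen (a : A) (b : B) : {freeg (A * B)%type / k} :=
  Freeg [:: (1, (a, b))].

Inductive trel : {freeg (A * B)%type / k} -> Prop :=
| trel_0 : trel 0
| trel_lin c x y of trel x & trel y : trel (c *: x + y)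
| trel_Dl a a' b : trel (tgen (a + a') b - (tgen a b + tgen a' b))
| trel_Dr a b b' : trel (tgen a (b + b') - (tgen a b + tgen a b'))
| trel_Zl c a b : trel (tgen (c *: a) b - c *: tgen a b)
| trel_Zr c a b : trel (tgen a (c *: b) - c *: tgen a b).

Definition trelb : {pred {freeg (A * B)%type / k}} := fun x => `[< trel x >].

Fact trelb_zmod_closed : zmod_closed trelb.
Proof.
split=> [|x y]; first by apply/asboolP; exact: trel_0.
move=> /asboolP hx /asboolP hy; apply/asboolP.
by rewrite -[x - y]addrC -scaleN1r; exact: trel_lin.
Qed.

HB.instance Definition _ := GRing.isZmodClosed.Build _ trelb trelb_zmod_closed.

Definition tensor := Quotient.quot trelb.

HB.instance Definition _ := Choice.on tensor.
HB.instance Definition _ := EqQuotient.on tensor.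
HB.instance Definition _ := ZmodQuotient.on tensor.

Fact trelbZ c x : x \in trelb -> c *: x \in trelb.
Proof.
move=> /asboolP hx; apply/asboolP; rewrite -[c *: x]addr0.
by apply: trel_lin => //; exact: trel_0.
Qed.

Definition tscale (c : k) (t : tensor) : tensor := \pi_tensor (c *: repr t).

Fact pi_tscale c x : tscale c (\pi_tensor x) = \pi_tensor (c *: x).
Proof.
apply/eqP; rewrite /tscale -Quotient.idealrBE -scalerBr; apply: trelbZ.
by rewrite Quotient.idealrBE reprK.
Qed.

Fact tscaleA c d t : tscale c (tscale d t) = tscale (c * d) t.
Proof.
by elim/quotW: t => x; rewrite (pi_tscale d) (pi_tscale c) pi_tscale scalerA.
Qed.

Fact tscale1 : left_id 1 tscale.
Proof. by elim/quotW => x; rewrite pi_tscale scale1r. Qed.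

Fact tscaleDr : right_distributive tscale +%R.
Proof.
move=> c; elim/quotW => x; elim/quotW => y.
by rewrite -raddfD !pi_tscale scalerDr raddfD.
Qed.

Fact tscaleDl t : {morph tscale^~ t : c d / c + d}.
Proof.
by elim/quotW: t => x c d; rewrite !pi_tscale scalerDl raddfD.
Qed.

HB.instance Definition _ :=
  GRing.Zmodule_isLmodule.Build k tensor tscaleA tscale1 tscaleDr tscaleDl.

End TensorProduct.

Section Pure.
Variables (k : fieldType) (A B : lmodType k).

Definition tpure (a : A) (b : B) : tensor A B := \pi_(tensor A B) (tgen a b).

Fact tpure_is_bilinear :
  bilinear_for (GRing.Scale.Law.clone _ _ *:%R _)
    (GRing.Scale.Law.clone _ _ *:%R _) tpure.
Proof.
have tZ c x : c *: (\pi_(tensor A B) x) = \pi_(tensor A B) (c *: x).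
  exact: pi_tscale.
have tD x y : \pi_(tensor A B) x + \pi_(tensor A B) y = \pi_(tensor A B) (x + y).
  by rewrite raddfD.
have tE x y : trel (x - y) -> \pi_(tensor A B) x = \pi_(tensor A B) y.
  by move=> h; apply/eqP; rewrite -Quotient.idealrBE; apply/asboolP.
split=> [b|a] c x y /=; rewrite /tpure.
  rewrite (tE _ _ (trel_Dl _ _ _)) -tD (tE _ _ (trel_Zl _ _ _)).
  by rewrite -tZ.
rewrite (tE _ _ (trel_Dr _ _ _)) -tD (tE _ _ (trel_Zr _ _ _)).
by rewrite -tZ.
Qed.

HB.instance Definition _ :=
  bilinear_isBilinear.Build k A B (tensor A B) _ _ tpure tpure_is_bilinear.

End Pure.

Notation "a ⊗ b" := (tpure a b) (at level 40, left associativity) : ring_scope.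

(* Sweedler-type notation: if t is represented by the formal combination of   *)
(* the pairs (a_i, b_i) with coefficients c_i, then \tsum_(a, b <- t) F a b   *)
(* is the sum of the c_i *: F a_i b_i. A representative of t is chosen, so    *)
(* this is meaningful only for bilinear F, in which case it does not depend   *)
(* on the representative (tsum_pi, tsum_pure, tsum_is_linear).                *)
Definition tsum (k : fieldType) (A B V : lmodType k) (F : A -> B -> V)
  (t : tensor A B) : V := fglift (fun ab : A * B => F ab.1 ab.2) (repr t).

Notation "\tsum_ ( a , b <- t ) F" := (tsum (fun a b => F) t)
  (at level 41, t at level 100, F at level 41, a name, b name,
   format "'[' \tsum_ ( a ,  b  <-  t ) '/  '  F ']'") : ring_scope.

Section TSum.
Variables (k : fieldType) (A B V : lmodType k).
Implicit Types (F G : A -> B -> V) (t : tensor A B) (c : k).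

Fact fglift_is_linear (K : choiceType) (f : K -> V) :
  linear (fglift f : {freeg K / k} -> V).
Proof.
pose g := GRing.isZmodMorphism.Build _ _ (fglift f) (lift_is_additive f).
pose fl : {additive {freeg K / k} -> V} := HB.pack (fglift f) g.
suff hZ c D : fglift f (c *: D) = c *: fglift f D.
  by move=> c D D'; rewrite -hZ; exact: (raddfD fl).
have fS (E : K -> {freeg K / k}) :
    fglift f (\sum_(x <- dom D) E x) = \sum_(x <- dom D) fglift f (E x).
  exact: (raddf_sum fl).
rewrite -[in RHS](freeg_sumE D) [in RHS]fS scaler_sumr [LHS]fS.
by apply: eq_bigr => x _; rewrite !liftU scalerA.
Qed.

Lemma tsum_pi F (Fl : forall b, linear (F^~ b)) (Fr : forall a, linear (F a))
    (D : {freeg (A * B)%type / k}) :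
  tsum F (\pi_(tensor A B) D) = fglift (fun ab : A * B => F ab.1 ab.2) D.
Proof.
set f := fun ab => _.
have lf := fglift_is_linear f.
pose fl : {linear {freeg (A * B)%type / k} -> V} :=
  HB.pack (fglift f) (GRing.isLinear.Build _ _ _ _ (fglift f) lf).
have fU a b : fl (tgen a b) = F a b by rewrite /= liftU scale1r.
have fl0 D' : trel D' -> fl D' = 0.
  elim=> {D'} [|c x y _ x0 _ y0|a a' b|a b b'|c a b|c a b].
  - exact: linear0.
  - by rewrite linearP x0 y0 scaler0 add0r.
  - have e : F (a + a') b = F a b + F a' b.
      by have := Fl b 1 a a'; rewrite /= !scale1r.
    by rewrite linearB linearD !fU e subrr.
  - have e : F a (b + b') = F a b + F a b'.
      by have := Fr a 1 b b'; rewrite !scale1r.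
    by rewrite linearB linearD !fU e subrr.
  - have e : F (c *: a) b = c *: F a b := scalable_linear (Fl b) c a.
    by rewrite linearB linearZ_LR !fU e subrr.
  - have e : F a (c *: b) = c *: F a b := scalable_linear (Fr a) c b.
    by rewrite linearB linearZ_LR !fU e subrr.
have /asboolP h : repr (\pi_(tensor A B) D) - D \in @trelb k A B.
  by rewrite Quotient.idealrBE reprK.
by apply/eqP; rewrite -subr_eq0 -[_ - _](linearB fl); apply/eqP/fl0.
Qed.

Lemma tsum_pure F : (forall b, linear (F^~ b)) -> (forall a, linear (F a)) ->
  forall a b, tsum F (a ⊗ b) = F a b.
Proof. by move=> Fl Fr a b; rewrite tsum_pi // liftU scale1r. Qed.

Lemma tsum_is_linear F :
  (forall b, linear (F^~ b)) -> (forall a, linear (F a)) -> linear (tsum F).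
Proof.
move=> Fl Fr c; elim/quotW => x; elim/quotW => y.
have -> : c *: \pi_(tensor A B) x + \pi_(tensor A B) y
    = \pi_(tensor A B) (c *: x + y).
  by rewrite raddfD; congr (_ + _); exact: pi_tscale.
by rewrite !tsum_pi // fglift_is_linear.
Qed.

Lemma tsum_lin c F G H t : (forall a b, H a b = c *: F a b + G a b) ->
  tsum H t = c *: tsum F t + tsum G t.
Proof.
move=> HE; rewrite /tsum.
have S (h : (A * B)%type -> V) (D : {freeg (A * B)%type / k}) :
    fglift h D = \sum_(x <- dom D) coeff x D *: h x.
  pose hl : {linear {freeg (A * B)%type / k} -> V} :=
    HB.pack (fglift h) (GRing.isLinear.Build _ _ _ _ _ (fglift_is_linear h)).
  rewrite -{1}[D]freeg_sumE [LHS](linear_sum hl).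
  by apply: eq_bigr => x _ /=; rewrite liftU.
rewrite !S scaler_sumr -big_split; apply: eq_bigr => x _ /=.
by rewrite HE scalerDr !scalerA mulrC.
Qed.

End TSum.

Section Theory.
Variable k : fieldType.

Lemma tensor_ind (A B : lmodType k) (P : tensor A B -> Prop) :
    P 0 -> (forall a b t, P t -> P (a ⊗ b + t)) -> forall t, P t.
Proof.
move=> P0 PD; elim/quotW => x; rewrite -[x]freeg_sumE.
elim: (dom x) => [|[a b] s IHs]; first by rewrite big_nil raddf0.
rewrite big_cons raddfD /=.
suff -> : \pi_(tensor A B) (Freeg [:: (coeff (a, b) x, (a, b))])
    = (coeff (a, b) x *: a) ⊗ b by exact: PD.
rewrite linearZl_LR /= /tpure [RHS]pi_tscale; congr (\pi_(tensor A B) _).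
apply/eqP/freeg_eqP => y.
by rewrite coeffZ !coeffU mul1r.
Qed.

Lemma tensor_ext (A B V : lmodType k) (f g : {linear tensor A B -> V}) :
  (forall a b, f (a ⊗ b) = g (a ⊗ b)) -> f =1 g.
Proof.
move=> fg; elim/tensor_ind => [|a b t IHt]; first by rewrite !linear0.
by rewrite !linearD fg IHt.
Qed.

End Theory.

Definition tmap (k : fieldType) (A B C D : lmodType k) (f : A -> C) (g : B -> D)
  (t : tensor A B) : tensor C D := \tsum_(a, b <- t) f a ⊗ g b.

Section TMap.
Variables (k : fieldType) (A B C D : lmodType k).
Variables (f : {linear A -> C}) (g : {linear B -> D}).

Fact tmap_lin_l b : linear (fun a => f a ⊗ g b).
Proof. by move=> c x y; rewrite linearP linearPl. Qed.

Fact tmap_lin_r a : linear (fun b => f a ⊗ g b).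
Proof. by move=> c x y; rewrite linearP linearPr. Qed.

Lemma tmap_pure a b : tmap f g (a ⊗ b) = f a ⊗ g b.
Proof. exact: (tsum_pure tmap_lin_l tmap_lin_r). Qed.

Fact tmap_is_linear : linear (tmap f g).
Proof. exact: (tsum_is_linear tmap_lin_l tmap_lin_r). Qed.

HB.instance Definition _ :=
  GRing.isLinear.Build k (tensor A B) (tensor C D) _ (tmap f g) tmap_is_linear.

End TMap.

Definition hom_associative (k : fieldType) (A : lmodType k)
    (mu : {linear tensor A A -> A}) (alpha : {linear A -> A}) : Prop :=
  (forall a a' : A, alpha (mu (a ⊗ a')) = mu (alpha a ⊗ alpha a')) /\
  (forall a a' a'' : A,
     mu (alpha a ⊗ mu (a' ⊗ a'')) = mu (mu (a ⊗ a') ⊗ alpha a'')).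

(* (a ⊗ b)(a' ⊗ b') = a_Q a'_R ⊗ b_R b'_Q, see twist_mul_pure                 *)
Definition twist_mul (k : fieldType) (A B : lmodType k)
    (muA : tensor A A -> A) (muB : tensor B B -> B)
    (R : tensor B A -> tensor A B) (Q : tensor A B -> tensor A B)
    (t : tensor (tensor A B) (tensor A B)) : tensor A B :=
  \tsum_(x, y <- t) \tsum_(a, b <- x) \tsum_(a', b' <- y)
    \tsum_(aQ, b'Q <- Q (a ⊗ b')) \tsum_(a'R, bR <- R (b ⊗ a'))
      muA (aQ ⊗ a'R) ⊗ muB (bR ⊗ b'Q).

Section TwistMul.
Variables (k : fieldType) (A B : lmodType k).
Variables (muA : {linear tensor A A -> A}) (muB : {linear tensor B B -> B}).
Variables (R : {linear tensor B A -> tensor A B}).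
Variables (Q : {linear tensor A B -> tensor A B}).

Let G u v x y := muA (u ⊗ x) ⊗ muB (y ⊗ v).
Let H w z := \tsum_(u, v <- z) \tsum_(x, y <- w) G u v x y.
Let L a b a' b' := H (R (b ⊗ a')) (Q (a ⊗ b')).
Let N s t := \tsum_(a, b <- s) \tsum_(a', b' <- t) L a b a' b'.

Let G1 v x y : linear (fun u => G u v x y).
Proof. by move=> c a b; rewrite /G linearPl !linearP linearPl. Qed.
Let G2 u x y : linear (fun v => G u v x y).
Proof. by move=> c a b; rewrite /G linearPr !linearP linearPr. Qed.
Let G3 u v y : linear (fun x => G u v x y).
Proof. by move=> c a b; rewrite /G linearPr !linearP linearPl. Qed.
Let G4 u v x : linear (fun y => G u v x y).
Proof. by move=> c a b; rewrite /G linearPl !linearP linearPr. Qed.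

Let Hin1 w v : linear (fun u => \tsum_(x, y <- w) G u v x y).
Proof. by move=> c a b; apply: tsum_lin => x y; exact: G1. Qed.
Let Hin2 w u : linear (fun v => \tsum_(x, y <- w) G u v x y).
Proof. by move=> c a b; apply: tsum_lin => x y; exact: G2. Qed.
Let H1 z : linear (H^~ z).
Proof.
move=> c a b; apply: tsum_lin => u v.
exact: (tsum_is_linear (G3 u v) (G4 u v)).
Qed.
Let H2 w : linear (H w).
Proof. exact: (tsum_is_linear (Hin1 w) (Hin2 w)). Qed.

Let L1 b a' b' : linear (fun a => L a b a' b').
Proof. by move=> c x y; rewrite /L linearPl linearP; exact: H2. Qed.
Let L2 a a' b' : linear (fun b => L a b a' b').
Proof. by move=> c x y; rewrite /L linearPl linearP; exact: H1. Qed.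
Let L3 a b b' : linear (fun a' => L a b a' b').
Proof. by move=> c x y; rewrite /L linearPr linearP; exact: H1. Qed.
Let L4 a b a' : linear (fun b' => L a b a' b').
Proof. by move=> c x y; rewrite /L linearPr linearP; exact: H2. Qed.

Let Nin1 t b : linear (fun a => \tsum_(a', b' <- t) L a b a' b').
Proof. by move=> c x y; apply: tsum_lin => a' b'; exact: L1. Qed.
Let Nin2 t a : linear (fun b => \tsum_(a', b' <- t) L a b a' b').
Proof. by move=> c x y; apply: tsum_lin => a' b'; exact: L2. Qed.
Let N1 t : linear (N^~ t).
Proof. exact: (tsum_is_linear (Nin1 t) (Nin2 t)). Qed.
Let N2 s : linear (N s).
Proof.
move=> c x y; apply: tsum_lin => a b.
exact: (tsum_is_linear (L3 a b) (L4 a b)).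
Qed.

Lemma twist_mul_pure (a a' : A) (b b' : B) :
  twist_mul muA muB R Q ((a ⊗ b) ⊗ (a' ⊗ b')) =
  \tsum_(aQ, b'Q <- Q (a ⊗ b')) \tsum_(a'R, bR <- R (b ⊗ a'))
    muA (aQ ⊗ a'R) ⊗ muB (bR ⊗ b'Q).
Proof.
rewrite [LHS](tsum_pure N1 N2) [LHS](tsum_pure (Nin1 _) (Nin2 _)).
exact: (tsum_pure (L3 a b) (L4 a b)).
Qed.

Fact twist_mul_is_linear : linear (twist_mul muA muB R Q).
Proof. exact: (tsum_is_linear N1 N2). Qed.

HB.instance Definition _ :=
  GRing.isLinear.Build k (tensor (tensor A B) (tensor A B)) (tensor A B) _
    (twist_mul muA muB R Q) twist_mul_is_linear.

End TwistMul.

(* Main.v *)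
(* On pure tensors, both sides of Hom-associativity expand to a sixfold       *)
(* Sweedler sum of                                                            *)
(*   (a_q a'_r) alpha(a''_p) ⊗ (b_p b'_q) alpha(b''_q)                        *)
(* once the multiplicativity conditions on R and Q and the Hom-associativity  *)
(* of A and B are applied. In one sum R acts on (b, a') after Q has acted on  *)
(* (a', b''), and Q acts on (a, b') after R has acted on (b', a''); in the    *)
(* other these orders are reversed. The two braid-type compatibilities of R   *)
(* and Q exchange the orders.                                                 *)
Require Import Defs.
From HB Require Import structures.
From mathcomp Require Import all_boot all_algebra.
From mathcomp Require Import generic_quotient.
From mathcomp.multinomials Require Import freeg.

Set Implicit Arguments.
Unset Strict Implicit.
Unset Printing Implicit Defensive.

Import GRing.Theory.
Local Open Scope ring_scope.

(** Both identities are linear in each factor, so [eq_linear_tensor] reduces them to pure tensors.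
    For multiplicativity, [hR] and [hQ] carry the structure maps through [R] and [Q], and [alphaA],
    [alphaB] respect the products. For Hom-associativity, [twist_mul_expand_l] and
    [twist_mul_expand_r] bring both sides to the same left-bracketed summand under six applications
    of [R] and [Q]. The sides differ only in which of two maps acts first, for the pair acting on
    [b], [a'], [b''] and for the pair acting on [a], [b'], [a'']. The first pair is reordered by
    [hRQA], the second by [hRQB]; [trilinear_lift] lets these equations of tensors act inside a
    sum. *)

Section TSumTheory.
Variable k : fieldType.
Implicit Types A B C D U V W : lmodType k.

(** The sum runs over one fixed representative, so congruence, exchange of sums and commutation with
    linear maps hold for arbitrary [F]; bilinearity matters only when the tensor itself is
    rewritten. *)
Lemma tsumE A B V (F : A -> B -> V) (t : tensor A B) :
  \tsum_(a, b <- t) F a b =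
  \sum_(x <- dom (repr t)) coeff x (repr t) *: F x.1 x.2.
Proof.
rewrite /tsum.
pose f := fun ab : A * B => F ab.1 ab.2.
pose fl : {linear {freeg (A * B)%type / k} -> V} :=
  HB.pack (fglift f) (GRing.isLinear.Build _ _ _ _ _ (fglift_is_linear f)).
rewrite -{1}[repr t]freeg_sumE [LHS](linear_sum fl).
by apply: eq_bigr => x _ /=; rewrite liftU.
Qed.

Lemma eq_tsum A B V (F G : A -> B -> V) (t : tensor A B) :
  (forall a b, F a b = G a b) ->
  \tsum_(a, b <- t) F a b = \tsum_(a, b <- t) G a b.
Proof. by move=> FG; rewrite !tsumE; apply: eq_bigr => x _; rewrite FG. Qed.

Lemma linear_tsum A B V W (f : V -> W) (F : A -> B -> V) (t : tensor A B) :
  linear f -> f (\tsum_(a, b <- t) F a b) = \tsum_(a, b <- t) f (F a b).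
Proof.
move=> lf.
pose fl : {linear V -> W} := HB.pack f (GRing.isLinear.Build _ _ _ _ f lf).
rewrite !tsumE [LHS](linear_sum fl).
by apply: eq_bigr => x _; rewrite [LHS](linearZ_LR fl).
Qed.

Lemma exchange_tsum A B C D V (F : A -> B -> C -> D -> V)
    (s : tensor A B) (t : tensor C D) :
  \tsum_(a, b <- s) \tsum_(c, d <- t) F a b c d =
  \tsum_(c, d <- t) \tsum_(a, b <- s) F a b c d.
Proof.
rewrite !tsumE.
under eq_bigr do rewrite tsumE scaler_sumr.
under [RHS]eq_bigr do rewrite tsumE scaler_sumr.
rewrite exchange_big; apply: eq_bigr => x _; apply: eq_bigr => y _.
by rewrite !scalerA mulrC.
Qed.

Lemma linear_id_fun V : linear (fun x : V => x).
Proof. by []. Qed.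

Lemma linear_app U V W (f : {linear V -> W}) (g : U -> V) :
  linear g -> linear (fun x => f (g x)).
Proof. by move=> lg c x y; rewrite lg linearP. Qed.

Lemma linear_purel U A B (g : U -> A) (b : B) :
  linear g -> linear (fun x => g x ⊗ b).
Proof. by move=> lg c x y; rewrite lg linearPl. Qed.

Lemma linear_purer U A B (a : A) (g : U -> B) :
  linear g -> linear (fun x => a ⊗ g x).
Proof. by move=> lg c x y; rewrite lg linearPr. Qed.

Lemma linear_tsum_body U A B V (F : U -> A -> B -> V) (t : tensor A B) :
  (forall a b, linear (fun x => F x a b)) ->
  linear (fun x => \tsum_(a, b <- t) F x a b).
Proof. by move=> lF c x y; apply: tsum_lin => a b; exact: lF. Qed.

Lemma linear_tsum_arg U A B V (F : A -> B -> V) (g : U -> tensor A B) :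
  (forall b, linear (F^~ b)) -> (forall a, linear (F a)) -> linear g ->
  linear (fun x => \tsum_(a, b <- g x) F a b).
Proof. by move=> Fl Fr lg c x y; rewrite lg (tsum_is_linear Fl Fr). Qed.

End TSumTheory.

(** The variable occurs once in each expression treated below, so linearity follows by descending to
    that occurrence. The last branch eta-expands partial applications. *)
Ltac prove_linear := intros; cbv beta;
  match goal with
  | |- linear (fun x => x) => exact: linear_id_fun
  | |- linear (fun x => tsum (@?F x) ?t) =>
      apply: (@linear_tsum_body _ _ _ _ _ F t); prove_linear
  | |- linear (fun x => tsum ?F (@?g x)) =>
      apply: (@linear_tsum_arg _ _ _ _ _ F g); prove_linear
  | |- linear (fun x => tpure (@?g x) ?b) =>
      apply: (@linear_purel _ _ _ _ g b); prove_linear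
  | |- linear (fun x => tpure ?a (@?g x)) =>
      apply: (@linear_purer _ _ _ _ a g); prove_linear
  | |- linear (fun x => _ (@?g x)) =>
      apply: (@linear_app _ _ _ _ _ g); prove_linear
  | |- linear ?f =>
      lazymatch f with
      | fun _ => _ => fail
      | _ => change (linear (fun x => f x)); prove_linear
      end
  end.

(** Bilinearity of [F] is essential: the representative chosen for the whole sum is unrelated to
    those chosen for the [G c d]. *)
Lemma tsum_tsum (k : fieldType) (A B C D V : lmodType k)
    (F : A -> B -> V) (G : C -> D -> tensor A B) (t : tensor C D) :
  (forall b, linear (F^~ b)) -> (forall a, linear (F a)) ->
  \tsum_(a, b <- \tsum_(c, d <- t) G c d) F a b =
  \tsum_(c, d <- t) \tsum_(a, b <- G c d) F a b.
Proof. by move=> Fl Fr; exact: linear_tsum (tsum_is_linear Fl Fr). Qed.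

Lemma eq_linear_tensor (k : fieldType) (A B V : lmodType k)
    (f g : tensor A B -> V) :
  linear f -> linear g -> (forall a b, f (a ⊗ b) = g (a ⊗ b)) ->
  forall t, f t = g t.
Proof.
move=> lf lg.
exact: (@tensor_ext _ _ _ _ (HB.pack f (GRing.isLinear.Build _ _ _ _ f lf))
  (HB.pack g (GRing.isLinear.Build _ _ _ _ g lg))).
Qed.

(** Universal property of the triple tensor product: applying [f] to an equation of triple tensors
    gives an equation of sums with summand [F]. *)
Lemma trilinear_lift (k : fieldType) (A B C V : lmodType k)
    (F : A -> B -> C -> V) :
  (forall b c, linear (fun a => F a b c)) ->
  (forall a c, linear (fun b => F a b c)) ->
  (forall a b, linear (F a b)) ->
  exists2 f : tensor (tensor A B) C -> V,
    linear f & forall a b c, f (a ⊗ b ⊗ c) = F a b c.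
Proof.
move=> F1 F2 F3.
exists (fun t => \tsum_(x, c <- t) \tsum_(a, b <- x) F a b c).
  apply: tsum_is_linear => [c|x]; first exact: tsum_is_linear.
  by apply: linear_tsum_body.
move=> a b c; rewrite tsum_pure; first by rewrite tsum_pure.
- by move=> {}c; exact: tsum_is_linear.
- by move=> x; apply: linear_tsum_body.
Qed.

Section TwistedProduct.
Variables (k : fieldType) (A B : lmodType k).
Variables (muA : {linear tensor A A -> A}) (alphaA : {linear A -> A}).
Variables (muB : {linear tensor B B -> B}) (alphaB : {linear B -> B}).
Variables (R : {linear tensor B A -> tensor A B}).
Variables (Q : {linear tensor A B -> tensor A B}).
Hypothesis hA : hom_associative muA alphaA.
Hypothesis hB : hom_associative muB alphaB.

Section Multiplicative.
Hypothesis hR : forall (a : A) (b : B),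
  \tsum_(aR, bR <- R (b ⊗ a)) (alphaA aR ⊗ alphaB bR)
  = R (alphaB b ⊗ alphaA a).
Hypothesis hQ : forall (a : A) (b : B),
  \tsum_(aQ, bQ <- Q (a ⊗ b)) (alphaA aQ ⊗ alphaB bQ)
  = Q (alphaA a ⊗ alphaB b).

Lemma tmap_twist_mul_pure a b a' b' :
  tmap alphaA alphaB (twist_mul muA muB R Q ((a ⊗ b) ⊗ (a' ⊗ b'))) =
  twist_mul muA muB R Q
    (tmap alphaA alphaB (a ⊗ b) ⊗ tmap alphaA alphaB (a' ⊗ b')).
Proof.
rewrite !tmap_pure !twist_mul_pure -hQ -hR tsum_tsum; [|prove_linear..].
rewrite linear_tsum; last exact: linearP.
apply: eq_tsum => aQ b'Q; rewrite tsum_pure; [|prove_linear..].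
rewrite tsum_tsum; [|prove_linear..].
rewrite linear_tsum; last exact: linearP.
apply: eq_tsum => a'R bR; rewrite tsum_pure; [|prove_linear..].
by rewrite tmap_pure hA.1 hB.1.
Qed.

End Multiplicative.

Local Notation E aa a' a'' bb b' b'' :=
  (muA (muA (aa ⊗ a') ⊗ alphaA a'') ⊗ muB (muB (bb ⊗ b') ⊗ alphaB b'')).

(** Splitting [R] by [hRA] and [Q] by [hQB] leaves products bracketed to the right;
    Hom-associativity of both factors turns them into [E]. *)
Lemma twist_mul_expand_l a b a' a'' b' b''
    (hRA : R (alphaB b ⊗ muA (a' ⊗ a''))
      = \tsum_(aR, bR <- R (b ⊗ a')) \tsum_(a'r, bRr <- R (bR ⊗ a''))
          (muA (aR ⊗ a'r) ⊗ alphaB bRr))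
    (hQB : Q (alphaA a ⊗ muB (b' ⊗ b''))
      = \tsum_(aQ, bQ <- Q (a ⊗ b')) \tsum_(aQq, b'q <- Q (aQ ⊗ b''))
          (alphaA aQq ⊗ muB (bQ ⊗ b'q))) :
  twist_mul muA muB R Q
    ((alphaA a ⊗ alphaB b) ⊗ (muA (a' ⊗ a'') ⊗ muB (b' ⊗ b''))) =
  \tsum_(aQ, b'Q <- Q (a ⊗ b')) \tsum_(aQq, b''q <- Q (aQ ⊗ b''))
    \tsum_(a'R, bR <- R (b ⊗ a')) \tsum_(a''r, bRr <- R (bR ⊗ a''))
      E aQq a'R a''r bRr b'Q b''q.
Proof.
rewrite twist_mul_pure hQB hRA tsum_tsum; [|prove_linear..].
apply: eq_tsum => aQ b'Q; rewrite tsum_tsum; [|prove_linear..].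
apply: eq_tsum => aQq b''q; rewrite tsum_pure; [|prove_linear..].
rewrite tsum_tsum; [|prove_linear..].
apply: eq_tsum => a'R bR; rewrite tsum_tsum; [|prove_linear..].
apply: eq_tsum => a''r bRr; rewrite tsum_pure; [|prove_linear..].
by rewrite hA.2 hB.2.
Qed.

(** Mirror image of [twist_mul_expand_l]: splitting by [hRB] and [hQA] yields the left bracketing of
    [E] directly. *)
Lemma twist_mul_expand_r a a' b b' a'' b''
    (hRB : R (muB (b ⊗ b') ⊗ alphaA a'')
      = \tsum_(aR, b'R <- R (b' ⊗ a'')) \tsum_(aRr, br <- R (b ⊗ aR))
          (alphaA aRr ⊗ muB (br ⊗ b'R)))
    (hQA : Q (muA (a ⊗ a') ⊗ alphaB b'')
      = \tsum_(a'Q, bQ <- Q (a' ⊗ b'')) \tsum_(aq, bQq <- Q (a ⊗ bQ))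
          (muA (aq ⊗ a'Q) ⊗ alphaB bQq)) :
  twist_mul muA muB R Q
    ((muA (a ⊗ a') ⊗ muB (b ⊗ b')) ⊗ (alphaA a'' ⊗ alphaB b'')) =
  \tsum_(a'Q, b''Q <- Q (a' ⊗ b'')) \tsum_(aq, b''Qq <- Q (a ⊗ b''Q))
    \tsum_(a''R, b'R <- R (b' ⊗ a'')) \tsum_(a''Rr, br <- R (b ⊗ a''R))
      E aq a'Q a''Rr br b'R b''Qq.
Proof.
rewrite twist_mul_pure hQA hRB tsum_tsum; [|prove_linear..].
apply: eq_tsum => a'Q b''Q; rewrite tsum_tsum; [|prove_linear..].
apply: eq_tsum => aq b''Qq; rewrite tsum_pure; [|prove_linear..].
rewrite tsum_tsum; [|prove_linear..].
apply: eq_tsum => a''R b'R; rewrite tsum_tsum; [|prove_linear..].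
by apply: eq_tsum => a''Rr br; rewrite tsum_pure; [|prove_linear..].
Qed.

End TwistedProduct.

Theorem proposition2p1 (k : fieldType) (A B : lmodType k)
    (muA : {linear tensor A A -> A}) (alphaA : {linear A -> A})
    (muB : {linear tensor B B -> B}) (alphaB : {linear B -> B})
    (R : {linear tensor B A -> tensor A B})
    (Q : {linear tensor A B -> tensor A B})
    (hA : hom_associative muA alphaA)
    (hB : hom_associative muB alphaB)
    (hR : forall (a : A) (b : B),
      \tsum_(aR, bR <- R (b ⊗ a)) (alphaA aR ⊗ alphaB bR)
      = R (alphaB b ⊗ alphaA a))
    (hQ : forall (a : A) (b : B),
      \tsum_(aQ, bQ <- Q (a ⊗ b)) (alphaA aQ ⊗ alphaB bQ)
      = Q (alphaA a ⊗ alphaB b))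
    (hRA : forall (a a' : A) (b : B),
      R (alphaB b ⊗ muA (a ⊗ a'))
      = \tsum_(aR, bR <- R (b ⊗ a)) \tsum_(a'r, bRr <- R (bR ⊗ a'))
          (muA (aR ⊗ a'r) ⊗ alphaB bRr))
    (hRB : forall (a : A) (b b' : B),
      R (muB (b ⊗ b') ⊗ alphaA a)
      = \tsum_(aR, b'R <- R (b' ⊗ a)) \tsum_(aRr, br <- R (b ⊗ aR))
          (alphaA aRr ⊗ muB (br ⊗ b'R)))
    (hQA : forall (a a' : A) (b : B),
      Q (muA (a ⊗ a') ⊗ alphaB b)
      = \tsum_(a'Q, bQ <- Q (a' ⊗ b)) \tsum_(aq, bQq <- Q (a ⊗ bQ))
          (muA (aq ⊗ a'Q) ⊗ alphaB bQq))
    (hQB : forall (a : A) (b b' : B),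
      Q (alphaA a ⊗ muB (b ⊗ b'))
      = \tsum_(aQ, bQ <- Q (a ⊗ b)) \tsum_(aQq, b'q <- Q (aQ ⊗ b'))
          (alphaA aQq ⊗ muB (bQ ⊗ b'q)))
    (hRQA : forall (a : A) (b b' : B),
      \tsum_(aR, bR <- R (b ⊗ a)) \tsum_(aRQ, b'Q <- Q (aR ⊗ b'))
          (bR ⊗ aRQ ⊗ b'Q)
      = \tsum_(aQ, b'Q <- Q (a ⊗ b')) \tsum_(aQR, bR <- R (b ⊗ aQ))
          (bR ⊗ aQR ⊗ b'Q))
    (hRQB : forall (a a' : A) (b : B),
      \tsum_(aR, bR <- R (b ⊗ a)) \tsum_(a'Q, bRQ <- Q (a' ⊗ bR))
          (aR ⊗ bRQ ⊗ a'Q)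
      = \tsum_(a'Q, bQ <- Q (a' ⊗ b)) \tsum_(aR, bQR <- R (bQ ⊗ a))
          (aR ⊗ bQR ⊗ a'Q)) :
  hom_associative (twist_mul muA muB R Q) (tmap alphaA alphaB).
Proof.
split=> [x y|x y z].
  move: x; apply: eq_linear_tensor; [prove_linear..|move=> a b].
  move: y; apply: eq_linear_tensor; [prove_linear..|move=> a' b'].
  exact: tmap_twist_mul_pure.
move: x; apply: eq_linear_tensor; [prove_linear..|move=> a b].
move: y; apply: eq_linear_tensor; [prove_linear..|move=> a' b'].
move: z; apply: eq_linear_tensor; [prove_linear..|move=> a'' b''].
rewrite /= !tmap_pure !twist_mul_pure.
(* Linearity moves the sums of the inner product outside, leaving products of the form treated by
   the expansion lemmas. *)
rewrite (linear_tsum (f := fun y => twist_mul muA muB R Q (_ ⊗ y)));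
  last by prove_linear.
rewrite (linear_tsum (f := fun y => twist_mul muA muB R Q (y ⊗ _)));
  last by prove_linear.
under eq_tsum => a'Q b''Q.
  rewrite (linear_tsum (f := fun y => twist_mul muA muB R Q (_ ⊗ y)));
    last by prove_linear.
  under eq_tsum do rewrite twist_mul_expand_l //.
  over.
under [RHS]eq_tsum => aQ b'Q.
  rewrite (linear_tsum (f := fun y => twist_mul muA muB R Q (y ⊗ _)));
    last by prove_linear.
  under eq_tsum do rewrite twist_mul_expand_r //.
  over.
have RQA (V : lmodType k) (F : B -> A -> B -> V) :
    (forall u v, linear (fun t => F t u v)) ->
    (forall t v, linear (fun u => F t u v)) ->
    (forall t u, linear (F t u)) ->
    \tsum_(aR, bR <- R (b ⊗ a')) \tsum_(aRQ, b'Q <- Q (aR ⊗ b''))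
      F bR aRQ b'Q
    = \tsum_(aQ, b'Q <- Q (a' ⊗ b'')) \tsum_(aQR, bR <- R (b ⊗ aQ))
      F bR aQR b'Q.
  move=> F1 F2 F3; have [f lf fE] := trilinear_lift F1 F2 F3.
  have := congr1 f (hRQA a' b b''); rewrite !(linear_tsum _ _ lf).
  under eq_tsum do rewrite (linear_tsum _ _ lf).
  under [in RHS]eq_tsum do rewrite (linear_tsum _ _ lf).
  under eq_tsum do under eq_tsum do rewrite fE.
  by under [in RHS]eq_tsum do under eq_tsum do rewrite fE.
have RQB (V : lmodType k) (F : A -> B -> A -> V) :
    (forall u v, linear (fun t => F t u v)) ->
    (forall t v, linear (fun u => F t u v)) ->
    (forall t u, linear (F t u)) ->
    \tsum_(aR, bR <- R (b' ⊗ a'')) \tsum_(a'Q, bRQ <- Q (a ⊗ bR))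
      F aR bRQ a'Q
    = \tsum_(a'Q, bQ <- Q (a ⊗ b')) \tsum_(aR, bQR <- R (bQ ⊗ a''))
      F aR bQR a'Q.
  move=> F1 F2 F3; have [f lf fE] := trilinear_lift F1 F2 F3.
  have := congr1 f (hRQB a'' a b'); rewrite !(linear_tsum _ _ lf).
  under eq_tsum do rewrite (linear_tsum _ _ lf).
  under [in RHS]eq_tsum do rewrite (linear_tsum _ _ lf).
  under eq_tsum do under eq_tsum do rewrite fE.
  by under [in RHS]eq_tsum do under eq_tsum do rewrite fE.
(* [K] holds the last [Q] and the last [R], shared by both sides: they act on outputs of the other
   four applications. *)
pose K u v w x y z := \tsum_(aQ, b''Q <- Q (z ⊗ w))
  \tsum_(a''R, bR <- R (u ⊗ x))
  (muA (muA (aQ ⊗ v) ⊗ alphaA a''R) ⊗ muB (muB (bR ⊗ y) ⊗ alphaB b''Q)).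
(* The sum for [R (b ⊗ a'Q)] is independent of those it crosses, so it can move next to the [Q] that
   produces [a'Q], where [RQA] applies. *)
transitivity (\tsum_(a'Q, b''Q <- Q (a' ⊗ b''))
    \tsum_(a'QR, bR <- R (b ⊗ a'Q))
    \tsum_(a''R, b'R <- R (b' ⊗ a'')) \tsum_(aQ, b'RQ <- Q (a ⊗ b'R))
      K bR a'QR b''Q a''R b'RQ aQ).
  apply: eq_tsum => a'Q b''Q; rewrite [RHS]exchange_tsum.
  apply: eq_tsum => a''R b'R; rewrite [RHS]exchange_tsum.
  by apply: eq_tsum => aQ b'RQ; exact: exchange_tsum.
rewrite -RQA; [|rewrite /K; prove_linear..].
(* The second reordering: [RQB] makes [Q] act on [a], [b'] before [R] acts on [a'']. *)
transitivity (\tsum_(a'R, bR <- R (b ⊗ a'))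
    \tsum_(a'RQ, b''Q <- Q (a'R ⊗ b''))
    \tsum_(aQ, b'Q <- Q (a ⊗ b')) \tsum_(a''R, b'QR <- R (b'Q ⊗ a''))
      K bR a'RQ b''Q a''R b'QR aQ).
  apply: eq_tsum => a'R bR; apply: eq_tsum => a'RQ b''Q.
  by apply: RQB; rewrite /K; prove_linear.
(* Both sides now apply the same maps; only the order of independent sums remains to be matched. *)
rewrite [RHS]exchange_tsum; apply: eq_tsum => a'R bR.
rewrite [RHS]exchange_tsum; apply: eq_tsum => a'RQ b''Q.
by apply: eq_tsum => aQ b'Q; exact: exchange_tsum.
Qed.
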